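(* Let $d \in \mathbb{N}$ and fix one of Dirichlet, Neumann, or periodic boundary conditions. The following assertion is false: there is $N > 0$ such that for all $\kappa > 0$, all $G \in (0, \kappa/(18 \mathrm{e} \sqrt{d})]$, all $\delta \in (0, G/2)$, all $(G,\delta)$-equidistributed sequences $Z$, all measurable and bounded $V : \mathbb{R}^d \to \mathbb{R}$, all $L \in G\mathbb{N}$, all $D \geq 1$ and all $\phi \in L^2(\Lambda_L)$ satisfying \[ \sum_{k \in \mathbb{N}} \max\{0, E_k\}^{\kappa} \lvert \alpha_k \rvert^2 \leq D \sum_{k \in \mathbb{N}} \lvert \alpha_k \rvert^2 , \] where $\alpha_k = \langle \psi_k, \phi \rangle$, we have \[ \lVert \phi \rVert_{L^2(W_\delta(L))}^2 \geq \left( \frac{\delta}{G} \right)^{N \left( 1 + G^{4/3} \lVert V \rVert_\infty^{2/3} + \ln D \right)} \lVert \phi \rVert_{L^2(\Lambda_L)}^2 . \]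
   Context: For $L > 0$, $\Lambda_L = (-L/2, L/2)^d \subset \mathbb{R}^d$, and $B(x,r)$ is the Euclidean ball with center $x$ and radius $r$. $\mathrm{e}$ is Euler's number, $\mathbb{N} = \{1,2,3,\ldots\}$ and $G\mathbb{N} = \{Gn : n \in \mathbb{N}\}$. $L^2(\Lambda_L)$ consists of complex-valued functions. $\Delta_L$ denotes the Laplace operator on $L^2(\Lambda_L)$ with the chosen (Dirichlet, Neumann, or periodic) boundary conditions. For a measurable and bounded $V : \mathbb{R}^d \to \mathbb{R}$, $V_L$ is the restriction of $V$ to $\Lambda_L$, and $H_L = -\Delta_L + V_L$ on $L^2(\Lambda_L)$, a lower semibounded self-adjoint operator with purely discrete spectrum. $\lVert \cdot \rVert_\infty$ is the $L^\infty$-norm. The eigenvalues of $H_L$ are denoted by $E_k$, $k \in \mathbb{N}$, enumerated in increasing order and counting multiplicities, and $\psi_k$, $k \in \mathbb{N}$, is a fixed corresponding orthonormal basis of eigenfunctions (the dependence of $E_k, \psi_k$ on $V$ and $L$ is suppressed). Given $G > 0$ and $\delta > 0$, a sequence $Z = (z_j)_{j \in (G\mathbb{Z})^d} \subset \mathbb{R}^d$ is called $(G,\delta)$-equidistributed if $B(z_j,\delta) \subset \Lambda_G + j = \{x + j : x \in \Lambda_G\}$ for all $j \in (G\mathbb{Z})^d$. For such a sequence and $L \in G\mathbb{N}$, set $W_\delta(L) = \bigcup_{j \in (G\mathbb{Z})^d} B(z_j,\delta) \cap \Lambda_L$ (the dependence on $G$ and $Z$ is suppressed in the notation). *)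

(* Defs.v *)
From HB Require Import structures.
From mathcomp Require Import all_boot all_order all_algebra.
From mathcomp Require Import complex.
From mathcomp Require Import all_classical all_reals all_analysis.

Set Implicit Arguments.
Unset Strict Implicit.
Unset Printing Implicit Defensive.

Import Order.TTheory GRing.Theory Num.Theory.
Import numFieldNormedType.Exports.

Local Open Scope classical_set_scope.
Local Open Scope ring_scope.

Definition measure_rV_display : measure_display -> measure_display.
Proof. exact. Qed.

(* The sigma-algebra on row vectors is generated by the coordinates; over the
   reals it is the Borel sigma-algebra of R^n. *)
Section measurable_rV.
Context {d} {T : measurableType d}.
Variable n : nat.

Let coors : 'I_n -> 'rV[T]_n -> T := fun i x => x ord0 i.

Let rV_set0 : g_sigma_preimage coors set0.
Proof. exact: sigma_algebra0. Qed.

Let rV_setC A : g_sigma_preimage coors A -> g_sigma_preimage coors (~` A).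
Proof. exact: sigma_algebraC. Qed.

Let rV_bigcup (F : _^nat) : (forall i, g_sigma_preimage coors (F i)) ->
  g_sigma_preimage coors (\bigcup_i (F i)).
Proof. exact: sigma_algebra_bigcup. Qed.

HB.instance Definition _ := @isMeasurable.Build (measure_rV_display d)
  'rV[T]_n (g_sigma_preimage coors) rV_set0 rV_setC rV_bigcup.

End measurable_rV.

Lemma measurable_coord_rV d (T : measurableType d) n (i : 'I_n) :
  measurable_fun [set: 'rV[T]_n] (fun x : 'rV[T]_n => x ord0 i).
Proof.
move=> _ Y mY; rewrite setTI; apply: sub_sigma_algebra => /=.
rewrite -bigcup_seq/=; exists i => /=; first by rewrite mem_index_enum.
by exists Y => //; rewrite setTI.
Qed.

Lemma measurable_fun_rVP d1 d2 (T1 : measurableType d1)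
    (T2 : measurableType d2) n (f : T1 -> 'rV[T2]_n) :
  (forall i, measurable_fun [set: T1] (fun x => f x ord0 i)) ->
  measurable_fun [set: T1] f.
Proof.
move=> mf _ A; rewrite setTI; move: A.
have sP : sigma_algebra setT [set A : set 'rV[T2]_n | measurable (f @^-1` A)].
  split=> /=.
  - by rewrite preimage_set0.
  - by move=> A mA; rewrite setTD preimage_setC; exact: measurableC.
  - by move=> F mF; rewrite preimage_bigcup; exact: bigcup_measurable.
apply: smallest_sub => // B; rewrite -bigcup_seq => -[i _] [C mC <-] /=.
by rewrite setTI; have := mf i measurableT C mC; rewrite setTI.
Qed.

Section lebesgue_rV.
Context {R : realType}.

Definition cons_rV n (p : measurableTypeR R * 'rV[R]_n) : 'rV[R]_n.+1 :=
  \row_i (if unlift ord0 i is Some j then p.2 ord0 j else p.1).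

Lemma measurable_cons_rV n : measurable_fun setT (@cons_rV n).
Proof.
apply: measurable_fun_rVP => i; case: (unliftP ord0 i) => [j|] ->.
- rewrite (_ : (fun _ => _) =
      (fun x : 'rV[R]_n => x ord0 j) \o (@snd (measurableTypeR R) 'rV[R]_n)).
    by apply: measurableT_comp => //; exact: measurable_coord_rV.
  by apply/funext => p; rewrite mxE liftK.
- rewrite (_ : (fun _ => _) = (@fst (measurableTypeR R) 'rV[R]_n)) //.
  by apply/funext => p; rewrite mxE unlift_none.
Qed.

Section step.
Variables (n : nat) (mu : {sigma_finite_measure set 'rV[R]_n -> \bar R}).

Definition lebesgue_step : set 'rV[R]_n.+1 -> \bar R :=
  pushforward (@lebesgue_measure R \x mu)%E (@cons_rV n).

Let step0 : lebesgue_step set0 = 0%E.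
Proof. by rewrite /lebesgue_step /pushforward preimage_set0 measure0. Qed.

Let step_ge0 A : (0 <= lebesgue_step A)%E.
Proof. by rewrite /lebesgue_step /pushforward; exact: measure_ge0. Qed.

Let step_sigma_additive : semi_sigma_additive lebesgue_step.
Proof.
move=> F mF tF mUF; rewrite /lebesgue_step /pushforward preimage_bigcup.
have mcons A : measurable A -> measurable (@cons_rV n @^-1` A).
  by move=> mA; have := @measurable_cons_rV n measurableT _ mA; rewrite setTI.
apply: measure_semi_sigma_additive.
- by move=> k; exact: mcons.
- apply/trivIsetP => /= i j _ _ ij; rewrite -preimage_setI.
  by move/trivIsetP : tF => /(_ _ _ _ _ ij) ->//; rewrite preimage_set0.
- by rewrite -preimage_bigcup; exact: mcons.
Qed.

HB.instance Definition _ := isMeasure.Build _ _ _ lebesgue_step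
  step0 step_ge0 step_sigma_additive.

Let step_sigma_finite : sigma_finite setT lebesgue_step.
Proof.
have /sigma_finiteP[A [TA ndA mA]] := sigma_finiteT (@lebesgue_measure R).
have /sigma_finiteP[B [TB ndB mB]] := sigma_finiteT mu.
pose F k := A k `*` B k.
have UF : setT = \bigcup_k F k.
  rewrite -setXTT TA TB predeqE => -[x y]; split=> [[/= [i _ Ax] [j _ By]]|].
    exists (maxn i j) => //; split.
    - by move: x Ax; exact/subsetPset/ndA/leq_maxl.
    - by move: y By; exact/subsetPset/ndB/leq_maxr.
  by move=> [i _ []/= ? ?]; split; exists i.
have mF k : measurable (F k) /\ ((@lebesgue_measure R \x mu) (F k) < +oo)%E.
  have [? ?] := mA k; have [? ?] := mB k.
  split; first exact: measurableX.
  by rewrite product_measure1E// lte_mul_pinfty// ge0_fin_numE.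
pose un (x : 'rV[R]_n.+1) : measurableTypeR R * 'rV[R]_n :=
  (x ord0 ord0, \row_j x ord0 (lift ord0 j)).
have consK : cancel (@cons_rV n) un.
  move=> [a y]; rewrite /un /cons_rV; congr pair.
    by rewrite mxE unlift_none.
  by apply/rowP => j; rewrite !mxE liftK.
have mun : measurable_fun setT un.
  apply/measurable_fun_pairP; split.
    exact: (@measurable_coord_rV _ (measurableTypeR R)).
  apply: measurable_fun_rVP => i.
  rewrite (_ : (fun _ => _) = (fun x : 'rV[R]_n.+1 => x ord0 (lift ord0 i))).
    exact: measurable_coord_rV.
  by apply/funext => x; rewrite mxE.
exists (fun k => un @^-1` F k).
  by rewrite -preimage_bigcup -UF preimage_setT.
move=> k; have [mFk Fkoo] := mF k; split.
  by have := mun measurableT _ mFk; rewrite setTI.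
rewrite /lebesgue_step /pushforward -comp_preimage.
by rewrite (_ : _ \o _ = id) //; apply/funext => x; exact: consK.
Qed.

HB.instance Definition _ := Measure_isSigmaFinite.Build _ _ _ lebesgue_step
  step_sigma_finite.

End step.

(* [leb n] is the Lebesgue measure of R^n, as an iterated product. *)
Fixpoint leb (n : nat) : {sigma_finite_measure set 'rV[R]_n -> \bar R} :=
  match n with
  | 0 => @dirac _ 'rV[R]_0 0 R
  | m.+1 => lebesgue_step (leb m)
  end.

End lebesgue_rV.

Section spaces.
Context {R : realType} {d : nat}.
Implicit Types (G L r delta : R) (j x : 'rV[R]_d) (Om : set 'rV[R]_d).

(* Lambda_L *)
Definition cube L : set 'rV[R]_d :=
  [set x | forall i, - (L / 2) < x ord0 i < L / 2].

(* The norm of the library on ['rV[R]_d] is the sup norm, hence the explicit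
   Euclidean distance. *)
Definition eball x r : set 'rV[R]_d :=
  [set y | Num.sqrt (\sum_(i < d) (y ord0 i - x ord0 i) ^+ 2) < r].

(* (G Z)^d *)
Definition lattice G : set 'rV[R]_d :=
  [set j | exists k : 'rV[int]_d, j = \row_i (G * (k ord0 i)%:~R)].

(* Only the values of [z] on [lattice G] matter, here and in [Wset]. *)
Definition equidistributed G delta (z : 'rV[R]_d -> 'rV[R]_d) : Prop :=
  forall j, lattice G j ->
    eball (z j) delta `<=` [set x + j | x in cube G].

Definition Wset G delta (z : 'rV[R]_d -> 'rV[R]_d) L : set 'rV[R]_d :=
  (\bigcup_(j in lattice G) eball (z j) delta) `&` cube L.

Definition infty_norm (V : 'rV[R]_d -> R) : R :=
  fine (Lnorm (leb d) +oo%E (EFin \o V)).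

(* Elements of L^2 are represented by functions defined on all of R^d; only
   their restriction to the domain, up to null sets, is ever used. *)
Notation Cfun := ('rV[R]_d -> R[i]).
Implicit Types (f u v w : Cfun) (g h : 'I_d -> Cfun).

Definition Lp2 Om f : Prop :=
  [/\ measurable_fun Om (fun x => complex.Re (f x)),
      measurable_fun Om (fun x => complex.Im (f x)) &
      (\int[leb d]_(x in Om) (Normc.normc (f x) ^+ 2)%:E < +oo)%E].

Definition cintegral Om f : R[i] :=
  Complex (\int[leb d]_(x in Om) complex.Re (f x))
          (\int[leb d]_(x in Om) complex.Im (f x)).

(* conjugate-linear in the first argument *)
Definition inner Om f1 f2 : R[i] :=
  cintegral Om (fun x => conjc (f1 x) * f2 x).

Definition normsq Om f : R := \int[leb d]_(x in Om) Normc.normc (f x) ^+ 2.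

Definition partial (i : 'I_d) (f : 'rV[R]_d -> R) : 'rV[R]_d -> R :=
  'D_(delta_mx ord0 i) f.

Definition smooth (f : 'rV[R]_d -> R) : Prop :=
  forall s : seq 'I_d,
    continuous (foldr partial f s) /\
    forall i x, derivable (foldr partial f s) x (delta_mx ord0 i).

Definition smoothC f : Prop :=
  smooth (fun y => complex.Re (f y)) /\ smooth (fun y => complex.Im (f y)).

Definition partialC (i : 'I_d) f : Cfun := fun x =>
  Complex (partial i (fun y => complex.Re (f y)) x)
          (partial i (fun y => complex.Im (f y)) x).

Definition Cc_infty Om f : Prop :=
  smoothC f /\
  exists K, [/\ compact K, K `<=` Om & forall x, ~ K x -> f x = 0].

Definition Cper_infty L f : Prop :=
  smoothC f /\ forall i x, f (x + L *: delta_mx ord0 i) = f x.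

(* [g] is the weak gradient of [u] *)
Definition weak_gradient Om u g : Prop :=
  forall i theta, Cc_infty Om theta ->
    cintegral Om (fun x => u x * partialC i theta x) =
    - cintegral Om (fun x => g i x * theta x).

(* [u] belongs to the Sobolev space H^1 and has weak gradient [g] *)
Definition H1 Om u g : Prop :=
  [/\ Lp2 Om u, forall i, Lp2 Om (g i) & weak_gradient Om u g].

(* [u] is in the H^1-closure of the class [S] of smooth functions *)
Definition H1_closure Om (S : set Cfun) u g : Prop :=
  H1 Om u g /\
  exists theta : nat -> Cfun, [/\ forall n, S (theta n),
    normsq Om (fun x => theta n x - u x) @[n --> \oo] --> (0 : R) &
    forall i,
      normsq Om (fun x => partialC i (theta n) x - g i x) @[n --> \oo]
        --> (0 : R)].

Inductive boundary_condition := Dirichlet | Neumann | Periodic.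

Implicit Type bc : boundary_condition.

(* Form domain of the Laplacian on [cube L], [g] being the gradient of [u]:
   H^1_0, H^1 and H^1_per, respectively. *)
Definition form_domain bc L u g : Prop :=
  match bc with
  | Dirichlet => H1_closure (cube L) (Cc_infty (cube L)) u g
  | Neumann => H1 (cube L) u g
  | Periodic => H1_closure (cube L) (Cper_infty L) u g
  end.

(* [u] is in the domain of Delta_L and - Delta_L u = f: the Laplacian with
   boundary conditions [bc] is the self-adjoint operator associated with the
   closed form <grad v, grad u> on [form_domain bc L]. *)
Definition neg_laplacian bc L u f : Prop :=
  Lp2 (cube L) f /\
  exists2 g, form_domain bc L u g &
    forall v h, form_domain bc L v h ->
      \sum_(i < d) inner (cube L) (h i) (g i) = inner (cube L) v f.

(* [u] is in the domain of H_L = - Delta_L + V_L and H_L u = f; as V is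
   bounded, this domain is the domain of Delta_L. *)
Definition schroedinger bc L (V : 'rV[R]_d -> R) u f : Prop :=
  neg_laplacian bc L u (fun x => f x - (V x)%:C%C * u x).

(* [E] enumerates the eigenvalues of H_L increasingly, with multiplicities,
   and [psi] is an orthonormal basis of corresponding eigenfunctions (indices
   start at 0). *)
Definition eigenbasis bc L (V : 'rV[R]_d -> R) (E : nat -> R)
    (psi : nat -> Cfun) : Prop :=
  [/\ {homo E : m n / (m <= n)%N >-> m <= n},
      forall k, schroedinger bc L V (psi k) (fun x => (E k)%:C%C * psi k x),
      forall k l, inner (cube L) (psi k) (psi l) = (k == l)%:R &
      forall f, Lp2 (cube L) f ->
        normsq (cube L)
          (fun x => f x - \sum_(k < n) inner (cube L) (psi k) f * psi k x)
          @[n --> \oo] --> (0 : R)].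

Definition measurable_bounded (V : 'rV[R]_d -> R) : Prop :=
  measurable_fun setT V /\ exists M : R, forall x, `|V x| <= M.

End spaces.

(* Main.v *)
Require Import Defs.
From HB Require Import structures.
From mathcomp Require Import all_boot all_order all_algebra.
From mathcomp Require Import complex.
From mathcomp Require Import ring lra zify.
From mathcomp Require Import all_classical all_reals all_analysis.
From mathcomp Require Import measurable_realfun.

Set Implicit Arguments.
Unset Strict Implicit.
Unset Printing Implicit Defensive.

Import Order.TTheory GRing.Theory Num.Theory.
Import numFieldNormedType.Exports.

Local Open Scope classical_set_scope.
Local Open Scope ring_scope.

(** Polynomially decaying spectral coefficients do not prevent a function from
    vanishing on an open set. The condition with exponent kappa only asks for a
    finite Sobolev norm of order kappa, which every smooth compactly supported
    function has, whereas the claimed inequality would force any function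
    satisfying it with some finite D, however large, to have positive mass on
    the balls.

    So take kappa = 2, V = 0, the largest admissible G, the single cell L = G,
    and a nonzero smooth function phi supported in the middle of the cell, away
    from balls of radius G/16 placed towards a corner ([Wset_bump_supp]). The
    right-hand side is zero and the left-hand side is positive; it remains to
    find D ([bounded_energy]). Since the bump is in the form domain for each of
    the three boundary conditions ([form_domain_bump]), the Laplacian can be
    moved from psi_k onto phi ([inner_neglap_bump]):
    <psi_k, - Laplacian phi> = E_k <psi_k, phi>. Bessel's inequality for the
    orthonormal family psi_k ([bessel]) then bounds the sum of the
    E_k^2 |alpha_k|^2 by the squared norm of the Laplacian of phi, and
    completeness gives a nonzero alpha_k.

    Membership in the form domain rests on integration by parts on the cube
    ([Rintegral_by_parts]), hence on the vanishing of the integral of a partial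
    derivative of a compactly supported function ([integral_partial]), and on
    the smoothness of phi. The latter comes from a class of functions generated
    by sine, cosine and exp(-1/t) that is stable under partial derivatives
    ([elementary_smooth]). *)

(** * Borel sets of R^n *)

Section measurability.
Context {R : realType} {n : nat}.
Implicit Types (x y : 'rV[R]_n) (f : 'rV[R]_n -> R).

Lemma measurable_coord (i : 'I_n) :
  measurable_fun setT (fun x => x ord0 i).
Proof. exact: measurable_coord_rV. Qed.

Definition box x (r : R) : set 'rV[R]_n :=
  [set y | forall i, `|y ord0 i - x ord0 i| < r].

Lemma measurable_box x r : measurable (box x r).
Proof.
rewrite (_ : box x r = \bigcap_(i in [set: 'I_n])
  ((fun y => y ord0 i) @^-1` `]x ord0 i - r, x ord0 i + r[%classic)).
  apply: fin_bigcap_measurable => // i _.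
  have := @measurable_coord i measurableT `]x ord0 i - r, x ord0 i + r[%classic.
  by rewrite setTI; apply.
apply/seteqP; split=> y /=.
  by move=> yx i _ /=; rewrite in_itv/= -ltr_distl.
by move=> yx i; have := yx i I; rewrite /= in_itv/= -ltr_distl.
Qed.

Lemma nbhs_box x (A : set 'rV[R]_n) :
  nbhs x A -> exists2 r, 0 < r & box x r `<=` A.
Proof.
move=> /nbhs_ballP[r /= r0 rA]; exists r => // y xy; apply: rA.
by split=> // i j; rewrite (ord1 i) /ball/= distrC; exact: xy.
Qed.

(** The sigma-algebra is generated by the coordinates, so boxes are measurable by
    construction, and an open set is the union of the countably many boxes with
    rational center and radius 1/(k+1) that it contains. *)
Lemma open_measurable_rV (U : set 'rV[R]_n) : open U -> measurable U.
Proof.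
move=> oU.
pose c (p : 'rV[rat]_n * nat) : set 'rV[R]_n :=
  box (map_mx (@ratr R) p.1) p.2.+1%:R^-1.
pose B k := if (unpickle k : option ('rV[rat]_n * nat)) is Some p
  then (if `[< c p `<=` U >] then c p else set0) else set0.
rewrite (_ : U = \bigcup_k B k).
  apply: bigcup_measurable => k _; rewrite /B; case: unpickle => // p.
  by case: ifP => // _; exact: measurable_box.
apply/seteqP; split=> [x Ux|x [k _]]; last first.
  by rewrite /B; case: unpickle => // p; case: ifP => // /asboolP; exact.
(* A rational center within r/2 of x leaves room for the whole box around it
   to stay in the box of radius r. *)
have [r r0 rU] := nbhs_box (open_nbhs_nbhs (conj oU Ux)).
have [m rm] : exists m : nat, m.+1%:R^-1 < r / 2.
  have r2 : 0 < r / 2 by rewrite divr_gt0.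
  have [m _ /(_ m (leqnn m)) /= mr] := near_infty_natSinv_lt (PosNum r2).
  by exists m.
have [q qx] : exists q : 'rV[rat]_n, box (map_mx (@ratr R) q) m.+1%:R^-1 x.
  have m0 : 0 < (m.+1%:R^-1 : R) by rewrite invr_gt0.
  have /choice[q qx] : forall i, exists q : rat,
      `|x ord0 i - ratr q| < m.+1%:R^-1.
    move: m0; set e := _^-1 => e0 i.
    have /rat_in_itvoo[q] : x ord0 i - e < x ord0 i + e by lra.
    rewrite in_itv/= => /andP[h1 h2]; exists q.
    by rewrite ltr_distlC; apply/andP; split; lra.
  by exists (\row_i q i) => i; rewrite !mxE.
exists (pickle (q, m)) => //; rewrite /B pickleK ifT //.
apply/asboolP => y yq; apply: rU => i.
move: rm (yq i) (qx i); rewrite !mxE/=; set e := _^-1 => rm h1 h2.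
have -> : y ord0 i - x ord0 i =
  (y ord0 i - ratr (q ord0 i)) - (x ord0 i - ratr (q ord0 i)) by lra.
by rewrite (le_lt_trans (ler_normB _ _))//; lra.
Qed.

Lemma continuous_measurable_rV f : continuous f -> measurable_fun setT f.
Proof.
move=> /continuousP cf; apply: (measurability _ (RGenOpens.measurableE R)).
move=> _ [_ [a [b ->] <-]]; rewrite setTI.
by apply: open_measurable_rV; apply: cf; exact: interval_open.
Qed.

Lemma row_continuous (T : topologicalType) (u : T -> 'rV[R]_n) (t : T) :
  (forall i, {for t, continuous (fun s => u s ord0 i)}) ->
  {for t, continuous u}.
Proof.
move=> cu A /nbhs_box[r r0 rA].
have : \forall s \near t, forall i, `|u s ord0 i - u t ord0 i| < r.
  apply: filter_forall => i; have /cvgrPdist_lt/(_ _ r0) := cu i.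
  by apply: filterS => s; rewrite distrC.
by apply: filterS => s h; apply: rA.
Qed.

End measurability.

(** * Integrals over cubes *)

Section leb_cube.
Context {R : realType}.

Lemma measurable_cube n (L : R) : measurable (@cube R n L).
Proof.
rewrite (_ : cube L = box 0 (L / 2)); first exact: measurable_box.
by apply/seteqP; split=> x /= h i; have := h i; rewrite mxE subr0 ltr_norml.
Qed.

Lemma leb_cube n (L : R) : 0 <= L -> leb n (cube L) = (L ^+ n)%:E.
Proof.
move=> L0; elim: n => [|n IHn].
  rewrite expr0 /= /dirac indicE mem_set// => i; by case: i.
transitivity ((@lebesgue_measure R \x leb n)%E
    (`]- (L / 2), L / 2[%classic `*` @cube R n L)).
  rewrite /= /lebesgue_step /pushforward; congr (_ _).
  apply/seteqP; split=> -[t y] /=.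
    move=> h; split; first by have := h ord0; rewrite mxE unlift_none in_itv.
    by move=> i; have := h (lift ord0 i); rewrite mxE liftK.
  move=> [/=]; rewrite in_itv/= => ht hy i; rewrite mxE.
  by case: unliftP => [j _|_] //=.
have e1 : @lebesgue_measure R `]- (L / 2), L / 2[%classic = L%:E.
  rewrite lebesgue_measure_itv/= lte_fin; case: ifPn => [_|].
    by rewrite -EFinB opprK -splitr.
  by rewrite -leNgt => h; congr EFin; lra.
rewrite product_measure1E//; last exact: measurable_cube.
transitivity (L%:E * (L ^+ n)%:E)%E; last by rewrite -EFinM exprS.
by congr (_ * _)%E; [exact: e1|exact: IHn].
Qed.

Lemma integrable_cube n (L C : R) (f : 'rV[R]_n -> R) : 0 <= L ->
  measurable_fun (cube L) f -> (forall x, cube L x -> `|f x| <= C) ->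
  (leb n).-integrable (cube L) (EFin \o f).
Proof.
move=> L0 mf fC; apply: measurable_bounded_integrable => //.
- exact: measurable_cube.
- by rewrite -[X in (X < _)%E]/(leb n (cube L)) leb_cube// ltry.
- exists C; split; first exact: num_real.
  by move=> M CM x /fC /le_trans; apply; exact: ltW.
Qed.

Lemma integral_off0 n (A : set 'rV[R]_n) (f : 'rV[R]_n -> \bar R) :
  (forall x, ~ A x -> f x = 0%E) ->
  (\int[leb n]_(x in A) f x = \int[leb n]_x f x)%E.
Proof.
move=> f0; rewrite integral_mkcond; apply: eq_integral => x _.
by rewrite patchE; case: ifPn => //; rewrite notin_setE => /f0.
Qed.

Lemma integrable_off0 n (L C : R) (f : 'rV[R]_n -> R) : 0 <= L ->
  measurable_fun setT f -> (forall x, `|f x| <= C) ->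
  (forall x, ~ cube L x -> f x = 0) ->
  (leb n).-integrable setT (EFin \o f).
Proof.
move=> L0 mf fC f0.
have <- : (EFin \o f) \_ (cube L) = EFin \o f.
  apply/funext => x /=; rewrite patchE; case: ifPn => //.
  by rewrite notin_setE => /f0 /= ->.
apply/(integrable_mkcond (EFin \o f) (measurable_cube L)).
by apply: (@integrable_cube _ _ C) => //; exact: measurable_funTS.
Qed.

(** The one-dimensional case of [integral_partial]: both endpoint values in the
    fundamental theorem of calculus vanish. *)
Lemma integral_derive_cpt (a : R) (F F' : R -> R) : 0 < a ->
  continuous F' -> (forall x : R, is_derive x 1 F (F' x)) ->
  (forall x, a <= `|x| -> F x = 0) -> (forall x, a <= `|x| -> F' x = 0) ->
  (\int[@lebesgue_measure R]_x (F' x)%:E = 0)%E.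
Proof.
move=> a0 cF' dF F0 F'0.
transitivity (\int[@lebesgue_measure R]_(x in `[(- a)%R, a]) (F' x)%:E)%E.
  rewrite [RHS]integral_mkcond; apply: eq_integral => x _.
  rewrite patchE; case: ifPn => //; rewrite notin_setE/= in_itv/= => /negP.
  rewrite -ler_norml -ltNge => /ltW ax; by rewrite F'0.
have cF : continuous F.
  move=> x; apply/differentiable_continuous/derivable1_diffP.
  by have [] := dF x.
rewrite (@continuous_FTC2 _ F' F); first 1 last.
- lra.
- exact: continuous_subspaceT.
- split.
  + by move=> x _; have [] := dF x.
  + by apply: cvg_at_right_filter; exact: cF.
  + by apply: cvg_at_left_filter; exact: cF.
- by move=> x _ /=; rewrite derive1E; have [_] := dF x.
have -> : F a = 0 by apply: F0; exact: ler_norm.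
have -> : F (- a) = 0 by apply: F0; rewrite normrN; exact: ler_norm.
by rewrite -EFinB subrr.
Qed.

End leb_cube.

(** * The integral of a partial derivative *)

Section divergence.
Context {R : realType}.

Lemma integrable_leb_step n (f : 'rV[R]_n.+1 -> R) :
  measurable_fun setT f -> (leb n.+1).-integrable setT (EFin \o f) ->
  (@lebesgue_measure R \x leb n)%E.-integrable setT
    (EFin \o (f \o @cons_rV R n)).
Proof.
move=> mf /integrableP[_ fi]; apply/integrableP; split.
  apply/measurable_EFinP; apply: measurableT_comp => //.
  exact: measurable_cons_rV.
rewrite (le_lt_trans _ fi)//.
pose mu := pushforward (@lebesgue_measure R \x leb n)%E (@cons_rV R n).
rewrite -[leRHS]/(\int[mu]_x `|(EFin \o f) x|)%E.
rewrite ge0_integral_pushforward//.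
- exact: measurable_cons_rV.
- by apply: measurableT_comp => //; exact/measurable_EFinP.
Qed.

Lemma integral_leb_step n (f : 'rV[R]_n.+1 -> R) :
  measurable_fun setT f -> (leb n.+1).-integrable setT (EFin \o f) ->
  (\int[leb n.+1]_x (f x)%:E =
   \int[@lebesgue_measure R \x leb n]_p (f (cons_rV p))%:E)%E.
Proof.
move=> mf fi.
pose mu := pushforward (@lebesgue_measure R \x leb n)%E (@cons_rV R n).
rewrite -[LHS]/(\int[mu]_x (EFin \o f) x)%E.
rewrite integral_pushforward//.
- exact: measurable_cons_rV.
- exact/measurable_EFinP.
- exact: integrable_leb_step.
Qed.

Lemma cons_rV_shift0 n (h t : R) (y : 'rV[R]_n) :
  cons_rV (h + t, y) = h *: delta_mx ord0 ord0 + cons_rV (t, y).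
Proof.
apply/rowP => i; rewrite !mxE; case: unliftP => [j|] -> /=.
  by rewrite mulr0 add0r.
by rewrite mulr1.
Qed.

Lemma cons_rV_shiftS n (h t : R) (j : 'I_n) (y : 'rV[R]_n) :
  cons_rV (t, h *: delta_mx ord0 j + y) =
  h *: delta_mx ord0 (lift ord0 j) + cons_rV (t, y).
Proof.
apply/rowP => i; rewrite !mxE; case: unliftP => [k|] -> /=.
  by rewrite !mxE (inj_eq lift_inj).
by rewrite mulr0 add0r.
Qed.

Lemma is_derive_section0 n (F : 'rV[R]_n.+1 -> R) (y : 'rV[R]_n) (t df : R) :
  is_derive (cons_rV (t, y)) (delta_mx ord0 ord0) F df ->
  is_derive t 1 (fun s => F (cons_rV (s, y))) df.
Proof.
have E : (fun h : R => h^-1 *: (((fun s => F (cons_rV (s, y))) \o shift t)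
    (h *: 1) - F (cons_rV (t, y)))) =
  (fun h : R => h^-1 *: ((F \o shift (cons_rV (t, y))) (h *: delta_mx ord0 ord0)
    - F (cons_rV (t, y)))).
  by apply/funext => h /=; rewrite -cons_rV_shift0 [h *: 1]mulr1.
by case; rewrite /derivable /derive -E => ? ?; split.
Qed.

Lemma is_derive_sectionS n (F : 'rV[R]_n.+1 -> R) (j : 'I_n) (y : 'rV[R]_n)
    (t df : R) :
  is_derive (cons_rV (t, y)) (delta_mx ord0 (lift ord0 j)) F df ->
  is_derive y (delta_mx ord0 j) (fun z => F (cons_rV (t, z))) df.
Proof.
have E : (fun h : R => h^-1 *: (((fun z => F (cons_rV (t, z))) \o shift y)
    (h *: delta_mx ord0 j) - F (cons_rV (t, y)))) =
  (fun h : R => h^-1 *: ((F \o shift (cons_rV (t, y)))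
    (h *: delta_mx ord0 (lift ord0 j)) - F (cons_rV (t, y)))).
  by apply/funext => h /=; rewrite -cons_rV_shiftS.
by case; rewrite /derivable /derive -E => ? ?; split.
Qed.

Lemma cons_rV_continuous1 n (y : 'rV[R]_n) :
  continuous (fun s : R => cons_rV (s, y)).
Proof.
move=> s; apply: row_continuous => i.
rewrite (_ : (fun _ => _) =
  fun s : R => if unlift ord0 i is Some j then y ord0 j else s).
  by case: unliftP => [j|] _; [exact: cst_continuous|exact: cvg_id].
by apply/funext => u; rewrite mxE.
Qed.

Lemma cons_rV_continuous2 n (t : R) :
  continuous (fun y : 'rV[R]_n => cons_rV (t, y)).
Proof.
move=> y; apply: row_continuous => i.
rewrite (_ : (fun _ => _) =
  fun y : 'rV[R]_n => if unlift ord0 i is Some j then y ord0 j else t).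
  by case: unliftP => [j|] _; [exact: coord_continuous|exact: cst_continuous].
by apply/funext => u; rewrite mxE.
Qed.

Lemma cons_rV_cube n (L t : R) (y : 'rV[R]_n) :
  cube L (cons_rV (t, y)) <-> `|t| < L / 2 /\ cube L y.
Proof.
rewrite ltr_norml; split=> [h|[ht hy] i].
  split; first by have := h ord0; rewrite mxE unlift_none.
  by move=> i; have := h (lift ord0 i); rewrite mxE liftK.
by rewrite mxE; case: unliftP => [j _|_] //=.
Qed.

(** By Fubini's theorem, along the recursive construction of the measure: if [i]
    is the first coordinate, the inner integral over that coordinate is zero by
    the fundamental theorem of calculus; otherwise the inner integral is over
    the remaining coordinates and is zero by induction on the dimension. The
    bound [C] and the vanishing of [F'] pass to sections, which keeps the
    induction free of any discussion of supports. *)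
Theorem integral_partial n (L C : R) (i : 'I_n) (F F' : 'rV[R]_n -> R) :
  0 < L -> continuous F' ->
  (forall x, is_derive x (delta_mx ord0 i) F (F' x)) ->
  (forall x, ~ cube L x -> F x = 0) -> (forall x, ~ cube L x -> F' x = 0) ->
  (forall x, `|F' x| <= C) ->
  (\int[leb n]_x (F' x)%:E = 0)%E.
Proof.
move=> L0; elim: n i F F' => [[]//|n IHn] i F F' cF' dF F0 F'0 F'C.
have mF' := continuous_measurable_rV cF'.
have iF' : (leb n.+1).-integrable setT (EFin \o F').
  exact: (integrable_off0 (ltW L0) mF' F'C F'0).
rewrite integral_leb_step//; have := integrable_leb_step mF' iF' => iF.
case: (unliftP ord0 i) => [j|] ij; last first.
- rewrite -[LHS](integral21_prod_meas1 iF); apply: integral0_eq => y _.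
  rewrite /fubini_G /=.
  apply: (@integral_derive_cpt _ (L / 2) (fun s => F (cons_rV (s, y)))).
  + by rewrite divr_gt0.
  + move=> s; apply: (@continuous_comp _ _ _ (fun s : R => cons_rV (s, y)) F').
      exact: cons_rV_continuous1.
    exact: cF'.
  + by move=> s; apply: is_derive_section0; rewrite -ij; exact: dF.
  + by move=> s Ls; apply: F0 => /cons_rV_cube[]; rewrite ltNge Ls.
  + by move=> s Ls; apply: F'0 => /cons_rV_cube[]; rewrite ltNge Ls.
- rewrite -[LHS](integral12_prod_meas1 iF); apply: integral0_eq => t _.
  rewrite /fubini_F /=.
  apply: (IHn j (fun y => F (cons_rV (t, y)))).
  + move=> s; apply: (@continuous_comp _ _ _ (fun y => cons_rV (t, y)) F').
      exact: cons_rV_continuous2.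
    exact: cF'.
  + by move=> y; apply: is_derive_sectionS; rewrite -ij; exact: dF.
  + by move=> y Ly; apply: F0 => /cons_rV_cube[].
  + by move=> y Ly; apply: F'0 => /cons_rV_cube[].
  + by move=> y.
Qed.

End divergence.

(** * A function that is flat at the origin *)

Section flat.
Context {R : realType}.
Implicit Types (p : {poly R}) (t u : R).

(** [flat 1] is the classical smooth function exp(-1/t), extended by zero to
    t <= 0; allowing a polynomial in 1/t as a factor gives a family that is
    closed under differentiation. *)
Definition flat p t : R := if 0 < t then p.[t^-1] * expR (- t^-1) else 0.

Definition dflat p : {poly R} := 'X^2 * (p - p^`()).

Lemma exprn_le_expR n u : 0 <= u -> u ^+ n <= n`!%:R * expR u.
Proof.
move=> u0; case: n => [|n].
  by rewrite expr0 mul1r -(expR0 R) ler_expR.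
rewrite mulrC -ler_pdivrMr ?ltr0n ?fact_gt0//.
by apply: le_trans (expR_ge1Dxn n u0); rewrite lerDr.
Qed.

(** The induction on [p] treats [p * 'X^n] for all [n] at once, because
    boundedness of [flat p] alone says nothing about [flat (p * 'X)]. *)
Lemma flat_bounded p : exists2 C, 0 < C & forall t, `|flat p t| <= C.
Proof.
suff H n : exists2 C, 0 < C & forall t, `|flat (p * 'X^n) t| <= C.
  by have := H 0%N; rewrite expr0 mulr1.
elim/poly_ind: p n => [|p c IH] n.
  by exists 1 => // t; rewrite mul0r /flat horner0 mul0r if_same normr0.
have [C C0 HC] := IH n.+1.
exists (C + `|c| * n`!%:R); first by rewrite ltr_pwDl// mulr_ge0.
move=> t; have := HC t; rewrite /flat; case: ifPn => t0; last first.
  by move=> _; rewrite normr0 addr_ge0// ?mulr_ge0// ltW.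
rewrite mulrDl -mulrA -exprS hornerD mulrDl => HCt.
rewrite (le_trans (ler_normD _ _))// lerD// hornerM hornerC hornerXn.
have v0 : 0 <= t^-1 by rewrite invr_ge0 ltW.
rewrite -mulrA normrM ler_wpM2l// ger0_norm; last first.
  by rewrite mulr_ge0 ?expR_ge0 ?exprn_ge0.
by rewrite expRN ler_pdivrMr ?expR_gt0// exprn_le_expR.
Qed.

(** Since [flat p t] is t^2 times [flat ('X^2 * p) t], which is bounded, it is
    O(t^2) at the origin. *)
Lemma is_derive_flat0 p : is_derive (0 : R) 1 (flat p) 0.
Proof.
have [C C0 HC] := flat_bounded ('X^2 * p).
have f0 : flat p 0 = 0 by rewrite /flat ltxx.
have fC t : `|flat p t| <= C * t ^+ 2.
  have := HC t; rewrite /flat; case: ifPn => t0.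
    rewrite hornerM hornerXn -mulrA normrM exprVn normrV;
      last by rewrite unitfE expf_neq0// gt_eqF.
    by rewrite ger0_norm ?sqr_ge0// mulrC ler_pdivrMr// exprn_gt0.
  by rewrite normr0 mulr_ge0// ?sqr_ge0// ltW.
apply/is_derive1_caratheodory; exists (fun z => flat p z / z); split.
- move=> z; rewrite f0 !subr0; have [->|z0] := eqVneq z 0.
    by rewrite f0 mulr0.
  by rewrite divfK.
- apply/cvgrPdist_lt => /= e e0; rewrite f0 mul0r.
  near=> z; rewrite sub0r normrN.
  have [->|z0] := eqVneq z 0; first by rewrite f0 mul0r normr0.
  rewrite normrM normrV ?unitfE// ltr_pdivrMr ?normr_gt0//.
  rewrite (le_lt_trans (fC z))// -real_normK ?num_real// expr2 mulrA.
  rewrite ltr_pM2r ?normr_gt0// mulrC -ltr_pdivlMr//.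
  near: z; apply/nbhs_ballP; exists (e / C) => /=; first by rewrite divr_gt0.
  by move=> z; rewrite /ball/= sub0r normrN.
- by rewrite f0 mul0r.
Unshelve. all: by end_near. Qed.

Lemma is_derive_flat p t : is_derive t 1 (flat p) (flat (dflat p) t).
Proof.
case: (ltgtP t 0) => t0.
- rewrite [X in is_derive _ _ _ X]/flat ltNge ltW//=.
  apply: (@near_eq_is_derive _ _ _ (cst 0)).
  near=> s; rewrite /flat ltNge ifF//; apply/negbF/ltW.
  by near: s; exact: lt_nbhsl.
- rewrite [X in is_derive _ _ _ X]/flat t0.
  apply: (@near_eq_is_derive _ _ _ (fun s : R => p.[s^-1] * expR (- s^-1))).
    by near=> s; rewrite /flat ifT//; near: s; exact: lt_nbhsr.
  have dV : is_derive t 1 (fun s : R => s^-1) (- t ^- 2).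
    have := @is_deriveV R id t 1 1; rewrite /= [_ *: 1]mulr1; apply.
      by rewrite gt_eqF.
  have dN : is_derive t 1 (fun s : R => - s^-1) (t ^- 2).
    by rewrite -[t ^- 2]opprK; exact: is_deriveN.
  have dP := @is_derive1_comp _ (horner p) _ t _ _ (is_derive_poly p t^-1) dV.
  have dE := @is_derive1_comp _ expR _ t _ _ (is_derive_expR (- t^-1)) dN.
  apply: (is_derive_eq (is_deriveM dP dE)); rewrite /= /dflat.
  rewrite hornerM hornerXn hornerD hornerN /GRing.scale/= exprVn; ring.
- rewrite t0 [X in is_derive _ _ _ X]/flat ltxx; exact: is_derive_flat0.
Unshelve. all: by end_near. Qed.

End flat.

(** * Smooth functions on R^n *)

Section directional.
Context {R : realType} {n : nat}.
Implicit Types (f : 'rV[R]_n -> R) (x v : 'rV[R]_n).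

(** Directional derivatives are derivatives along a line, which brings in the
    one-variable chain rule. *)
Lemma is_derive_line f x v df :
  is_derive x v f df <-> is_derive (0 : R) 1 (fun h => f (h *: v + x)) df.
Proof.
have E : (fun h : R => h^-1 *: (((fun h => f (h *: v + x)) \o shift 0) (h *: 1)
    - f (0 *: v + x))) =
  (fun h : R => h^-1 *: ((f \o shift x) (h *: v) - f x)).
  by apply/funext => h /=; rewrite scale0r add0r addr0 [h *: 1]mulr1.
by split; case; rewrite /derivable /derive ?E => ? ?; split;
  rewrite /derivable /derive ?E.
Qed.

Lemma is_derive_chain (h : R -> R) f x v dh df :
  is_derive (f x) 1 h dh -> is_derive x v f df ->
  is_derive x v (fun y => h (f y)) (dh * df).
Proof.
move=> Hh /is_derive_line Hf; apply/is_derive_line.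
apply: (@is_derive1_comp _ h (fun s : R => f (s *: v + x))) => //.
by rewrite scale0r add0r.
Qed.

Lemma is_derive_coord x v (j : 'I_n) :
  is_derive x v (fun y => y ord0 j) (v ord0 j).
Proof.
apply/is_derive_line.
rewrite (_ : (fun _ => _) = (fun h : R => v ord0 j * h + x ord0 j)).
  apply: (is_derive_eq (@is_deriveD R R R (v ord0 j \*: id) (cst (x ord0 j)) 0 1
    _ _ _ _)).
  by rewrite addr0 [_ *: _]mulr1.
by apply/funext => h; rewrite !mxE mulrC.
Qed.

(** Smoothness quantifies over all iterated partial derivatives, so it is
    obtained from a class of continuous functions that is closed under taking
    partial derivatives. *)
Inductive elementary : ('rV[R]_n -> R) -> Prop :=
| elem_cst c : elementary (fun=> c)
| elem_cos (w : R) i : elementary (fun x => cos (w * x ord0 i))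
| elem_sin (w : R) i : elementary (fun x => sin (w * x ord0 i))
| elem_flat p f : elementary f -> elementary (fun x => flat p (f x))
| elem_add f g : elementary f -> elementary g ->
    elementary (fun x => f x + g x)
| elem_mul f g : elementary f -> elementary g ->
    elementary (fun x => f x * g x).

Lemma elementary_sum (I : Type) (s : seq I) (f : I -> 'rV[R]_n -> R) :
  (forall i, elementary (f i)) -> elementary (fun x => \sum_(i <- s) f i x).
Proof.
move=> ef; elim: s => [|i s IHs].
  rewrite (_ : (fun _ => _) = fun=> 0); first exact: elem_cst.
  by apply/funext => x; rewrite big_nil.
rewrite (_ : (fun _ => _) = (fun x => f i x + \sum_(i <- s) f i x)).
  exact: elem_add.
by apply/funext => x; rewrite big_cons.
Qed.

Lemma derivable1_continuous (h : R -> R) (dh : R -> R) :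
  (forall t : R, is_derive t 1 h (dh t)) -> continuous h.
Proof.
move=> Hh t; apply/differentiable_continuous/derivable1_diffP.
by have [] := Hh t.
Qed.

Lemma elementary_continuous f : elementary f -> continuous f.
Proof.
have cw w i : continuous (fun x : 'rV[R]_n => w * x ord0 i).
  move=> x; apply: (@continuousM _ _ (cst w) (fun y : 'rV[R]_n => y ord0 i)).
    exact: cst_continuous.
  exact: coord_continuous.
elim=> [c|w i|w i|p {}f _ cf|{}f g _ cf _ cg|{}f g _ cf _ cg] x.
- exact: cst_continuous.
- apply: (@continuous_comp _ _ _ (fun y : 'rV[R]_n => w * y ord0 i) cos).
    exact: cw.
  exact: continuous_cos.
- apply: (@continuous_comp _ _ _ (fun y : 'rV[R]_n => w * y ord0 i) sin).
    exact: cw.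
  exact: continuous_sin.
- apply: (@continuous_comp _ _ _ f (flat p)); first exact: cf.
  exact: (derivable1_continuous (is_derive_flat p)).
- by apply: (@continuousD _ _ _ f g); [exact: cf|exact: cg].
- by apply: (@continuousM _ _ f g); [exact: cf|exact: cg].
Qed.

Lemma elementary_is_derive f v : elementary f ->
  exists2 g, elementary g & forall x, is_derive x v f (g x).
Proof.
have dw w i x : is_derive x v (fun x : 'rV[R]_n => w * x ord0 i) (w * v ord0 i).
  exact: (@is_deriveZ _ _ _ _ w _ _ _ (is_derive_coord x v i)).
elim=> [c|w i|w i|p {}f ef [f' ef' df]|{}f g ef [f' ef' df] eg [g' eg' dg]
  |{}f g ef [f' ef' df] eg [g' eg' dg]].
- exists (fun=> 0); first exact: elem_cst.
  by move=> x; exact: is_derive_cst.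
- exists (fun x => sin (w * x ord0 i) * - (w * v ord0 i)).
    by apply: elem_mul; [exact: elem_sin|exact: elem_cst].
  move=> x; rewrite mulrN -mulNr.
  by apply: (is_derive_chain (is_derive_cos _)).
- exists (fun x => cos (w * x ord0 i) * (w * v ord0 i)).
    by apply: elem_mul; [exact: elem_cos|exact: elem_cst].
  by move=> x; apply: (is_derive_chain (is_derive_sin _)).
- exists (fun x => flat (dflat p) (f x) * f' x).
    by apply: elem_mul => //; exact: elem_flat.
  by move=> x; apply: is_derive_chain; first exact: is_derive_flat.
- exists (fun x => f' x + g' x); first exact: elem_add.
  by move=> x; exact: (is_deriveD (df x) (dg x)).
- exists (fun x => f x * g' x + g x * f' x).
    by apply: elem_add; exact: elem_mul.
  by move=> x; exact: (is_deriveM (df x) (dg x)).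
Qed.

Lemma elementary_partial i f : elementary f -> elementary (partial i f).
Proof.
move=> /(elementary_is_derive (delta_mx ord0 i))[g eg dg].
suff -> : partial i f = g by [].
by apply/funext => x; rewrite /partial; have [] := dg x.
Qed.

Lemma elementary_smooth f : elementary f -> smooth f.
Proof.
move=> ef s; have {}ef : elementary (foldr partial f s).
  by elim: s => // i s; exact: elementary_partial.
split; first exact: elementary_continuous.
move=> i x; have [g _ dg] := elementary_is_derive (delta_mx ord0 i) ef.
by have [] := dg x.
Qed.

Lemma smooth_partial i f : smooth f -> smooth (partial i f).
Proof. by move=> sf s; rewrite -foldr_rcons; exact: sf. Qed.

Lemma smooth_continuous f : smooth f -> continuous f.
Proof. by move=> /(_ [::])[]. Qed.

Lemma smooth_is_derive f i x : smooth f ->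
  is_derive x (delta_mx ord0 i) f (partial i f x).
Proof. by move=> /(_ [::])[_ df]; split=> //; exact: df. Qed.

Lemma near_partial f g x s : {near x, f =1 g} ->
  {near x, foldr partial f s =1 foldr partial g s}.
Proof.
move=> fg; elim: s => //= i s IHs.
have /= := nbhs_interior IHs; apply: filterS => y; exact: near_eq_derive.
Qed.

(** Derivatives only depend on germs; this is what makes a function glued from
    smooth pieces smooth. *)
Lemma smooth_local f :
  (forall x, exists2 g, smooth g & {near x, f =1 g}) -> smooth f.
Proof.
move=> lf s.
have gf (x : 'rV[R]_n) : exists2 g, smooth g &
    \forall y \near x, foldr partial g s y = foldr partial f s y.
  have [g sg /(near_partial s) fg] := lf x; exists g => //.
  by move: fg; apply: filterS => y.
split=> [x|i x]; have [g sg {}gf] := gf x.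
  have [cg _] := sg s; have := cg x.
  rewrite /continuous_at (nbhs_singleton gf).
  exact: (cvg_trans (near_eq_cvg gf)).
by have [_ /(_ i x)] := sg s; exact: near_eq_derivable.
Qed.

End directional.

(** * Integration by parts *)

Section integration_by_parts.
Context {R : realType} {n : nat}.
Implicit Types (f g : 'rV[R]_n -> R) (K : set 'rV[R]_n).

Lemma off_compact_bounded K f : compact K -> continuous f ->
  (forall x, ~ K x -> f x = 0) -> exists C : R, forall x, `|f x| <= C.
Proof.
move=> cK cf f0.
have /compact_bounded[M [_ HM]] : compact (f @` K).
  by apply: continuous_compact => //; exact: continuous_subspaceT.
exists (`|M| + 1) => x; have [Kx|/f0->] := pselect (K x); last first.
  by rewrite normr0 addr_ge0.
by apply: HM; [rewrite (le_lt_trans (ler_norm M))// ltrDl|exists x].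
Qed.

Lemma partial_off K f i x : closed K -> (forall x, ~ K x -> f x = 0) ->
  ~ K x -> partial i f x = 0.
Proof.
move=> cK f0 Kx; rewrite /partial (@near_eq_derive _ _ _ _ (cst 0)).
  exact: derive_cst.
have := open_nbhs_nbhs (conj (closed_openC cK) Kx).
by apply: filterS => y; exact: f0.
Qed.

Lemma Rintegral_by_parts (L : R) K f g i : 0 < L ->
  compact K -> K `<=` cube L -> (forall x, ~ K x -> f x = 0) ->
  smooth f -> smooth g ->
  \int[leb n]_(x in cube L) (f x * partial i g x) =
  - \int[leb n]_(x in cube L) (partial i f x * g x).
Proof.
move=> L0 cK KL f0 sf sg.
have clK : closed K by apply: compact_closed => //; exact: norm_hausdorff.
have df0 x (Kx : ~ K x) : partial i f x = 0 by exact: (partial_off i clK f0 Kx).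
have cM (u v : 'rV[R]_n -> R) : continuous u -> continuous v ->
    continuous (fun x => u x * v x).
  by move=> cu cv x; apply: (@continuousM _ _ u v); [exact: cu|exact: cv].
have cf := smooth_continuous sf; have cg := smooth_continuous sg.
have c1 := cM _ _ cf (smooth_continuous (smooth_partial i sg)).
have c2 := cM _ _ (smooth_continuous (smooth_partial i sf)) cg.
have off (h : 'rV[R]_n -> R) : (forall x, ~ K x -> h x = 0) ->
    forall x, ~ cube L x -> h x = 0.
  by move=> h0 x Lx; apply: h0 => /KL.
have z1 x (Kx : ~ K x) : f x * partial i g x = 0 by rewrite f0// mul0r.
have z2 x (Kx : ~ K x) : partial i f x * g x = 0 by rewrite df0// mul0r.
have int (h : 'rV[R]_n -> R) (ch : continuous h)
    (h0 : forall x, ~ K x -> h x = 0) :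
    (leb n).-integrable (cube L) (EFin \o h).
  have [C HC] := off_compact_bounded cK ch h0.
  apply: (integrable_cube (ltW L0) (C := C)) => //.
  by apply: measurable_funTS; exact: continuous_measurable_rV.
apply/eqP; rewrite -addr_eq0 -RintegralD//; last 3 first.
- exact: measurable_cube.
- exact: int.
- exact: int.
rewrite /Rintegral; apply/eqP; rewrite integral_off0; last first.
  by move=> x Lx; rewrite (off _ z1)// (off _ z2)// addr0.
have c3 : continuous (fun x => f x * partial i g x + partial i f x * g x).
  by move=> x; apply: (@continuousD _ _ _ (fun x => f x * partial i g x)
    (fun x => partial i f x * g x)); [exact: c1|exact: c2].
have z3 x (Kx : ~ K x) : f x * partial i g x + partial i f x * g x = 0.
  by rewrite z1// z2// addr0.
have [C HC] := off_compact_bounded cK c3 z3.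
have dF x : is_derive x (delta_mx ord0 i) (fun y => f y * g y)
    (f x * partial i g x + partial i f x * g x).
  rewrite [partial i f x * _]mulrC.
  exact: (is_deriveM (smooth_is_derive i x sf) (smooth_is_derive i x sg)).
have offF x (Lx : ~ cube L x) : f x * g x = 0 by rewrite (off _ f0)// mul0r.
by rewrite (integral_partial L0 c3 dF offF (off _ z3) HC).
Qed.

End integration_by_parts.

(** * A test function supported around the center of the cube *)

Section cube_bump.
Context {R : realType} {d : nat} (d0 : (0 < d)%N) (L : R) (L0 : 0 < L).
Local Notation w := (2 * pi / L).

(** Since cosines are at most 1, this can only be positive where each of the
    [d] cosines is, that is, near the points of (L Z)^d. *)
Definition level (x : 'rV[R]_d) : R :=
  \sum_(i < d) cos (w * x ord0 i) - d.-1%:R.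

(** The one formula serves all boundary conditions: its restriction to the cube
    extends by zero to a compactly supported function, and it is itself a
    smooth L-periodic extension of that restriction. *)
Definition periodic_bump (x : 'rV[R]_d) : R := flat 1 (level x).

Definition cube_bump (x : 'rV[R]_d) : R := periodic_bump x * \1_(cube L) x.

Definition bump_supp : set 'rV[R]_d := [set x | forall i, `|x ord0 i| <= L / 4].

Lemma elementary_periodic_bump : elementary periodic_bump.
Proof.
apply: elem_flat; apply: elem_add; last exact: elem_cst.
by apply: elementary_sum => i; exact: elem_cos.
Qed.

Lemma smooth_periodic_bump : smooth periodic_bump.
Proof. exact: elementary_smooth elementary_periodic_bump. Qed.

Lemma periodic_bump_periodic i x :
  periodic_bump (x + L *: delta_mx ord0 i) = periodic_bump x.
Proof.
rewrite /periodic_bump /level; congr (flat _ (_ - _)); apply: eq_bigr => j _.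
rewrite !mxE mulrDr eqxx/=; case: eqP => _; last by rewrite !mulr0 addr0.
by rewrite mulr1 divfK ?gt_eqF// mulr_natl cosD2pi.
Qed.

Lemma periodic_bump_supp x : cube L x -> periodic_bump x != 0 -> bump_supp x.
Proof.
rewrite /periodic_bump /flat; case: ifPn => [+ Lx _ i|]; last by rewrite eqxx.
rewrite /level subr_gt0 (bigD1 i)//= => sum_gt.
have cos_gt0 : 0 < cos (w * x ord0 i).
  have := @ler_sum _ _ (index_enum 'I_d) (fun j => j != i)
    (fun j => cos (w * x ord0 j)) (fun=> 1) (fun j _ => cos_le1 _).
  rewrite [leRHS]sumr_const (_ : #|_| = d.-1).
    by move=> sum_le; lra.
  by rewrite cardC1 card_ord.
have [] // := leP `|x ord0 i| (L / 4) => xi.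
have /andP[x1 x2] := Lx i.
(* For L/4 < |x_i| < L/2 the argument of the cosine lies between pi/2 and pi. *)
suff : cos (w * `|x ord0 i|) <= 0.
  rewrite leNgt; have [xp|xn] := leP 0 (x ord0 i).
    by rewrite ger0_norm// cos_gt0.
  by rewrite ltr0_norm// mulrN cosN cos_gt0.
have w0 : 0 < w by rewrite divr_gt0// mulr_gt0// pi_gt0.
have wL (r : R) : w * (L / r) = 2 * pi / r by rewrite mulrA divfK ?gt_eqF.
have lo : pi / 2 < w * `|x ord0 i|.
  by rewrite [ltLHS](_ : _ = w * (L / 4)) ?ltr_pM2l// wL; lra.
have hi : w * `|x ord0 i| <= pi.
  rewrite [leRHS](_ : _ = w * (L / 2)) ?ler_pM2l//; last by rewrite wL; lra.
  by rewrite ler_norml; apply/andP; split; exact: ltW.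
have pi0 := pi_gt0 R.
rewrite ltW// -(cos_pihalf R) ltr_cos// in_itv/=; apply/andP; split; lra.
Qed.

Lemma open_cube : open (@cube R d L).
Proof.
have nc (x : 'rV[R]_d) : cube L x ->
    forall i : 'I_d, nbhs x [set y : 'rV[R]_d | - (L / 2) < y ord0 i < L / 2].
  move=> Lx i; have : x ord0 i \in `]- (L / 2), L / 2[.
    by rewrite in_itv/=; exact: Lx.
  move=> /near_in_itvoo /(@coord_continuous R 1 d ord0 i x) xi.
  have : nbhs x [set y : 'rV[R]_d | y ord0 i \in `]- (L / 2), L / 2[].
    exact: xi.
  by apply: filterS => y /=; rewrite in_itv.
by rewrite openE => x /nc H; exact: (@filter_forall _ 'I_d _ (nbhs x) _ H).
Qed.

Lemma cube_bump_off x : ~ bump_supp x -> cube_bump x = 0.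
Proof.
move=> Kx; rewrite /cube_bump indicE.
have [Lx|Lx] := pselect (cube L x); last first.
  by rewrite memNset// mulr0.
rewrite mem_set// mulr1; apply/eqP/negPn/negP => /(periodic_bump_supp Lx).
exact.
Qed.

Lemma compact_bump_supp : compact bump_supp.
Proof.
suff -> : bump_supp =
    [set v | forall i, (fun=> `[- (L / 4), L / 4]%classic) i (v ord0 i)].
  exact: (@rV_compact R d (fun=> _) (fun=> @segment_compact _ _ _)).
by apply/seteqP; split=> x /= h i; have := h i; rewrite /= in_itv/= ler_norml.
Qed.

Lemma bump_supp_cube : bump_supp `<=` cube L.
Proof.
have L4 : L / 4 < L / 2 by have := L0; lra.
by move=> x h i; rewrite -ltr_norml (le_lt_trans (h i)).
Qed.

(** Around a point of the open cube it agrees with [periodic_bump]; any other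
    point lies in the open complement of [bump_supp], where it is zero. *)
Lemma smooth_cube_bump : smooth cube_bump.
Proof.
apply: smooth_local => x; have [Lx|Lx] := pselect (cube L x).
  exists periodic_bump; first exact: smooth_periodic_bump.
  have := open_nbhs_nbhs (conj open_cube Lx); apply: filterS => y Ly.
  by rewrite /cube_bump indicE mem_set// mulr1.
exists (fun=> 0); first exact: elementary_smooth (elem_cst _).
have Kx : ~ bump_supp x by move=> /bump_supp_cube.
have clK : closed bump_supp.
  by apply: compact_closed; [exact: norm_hausdorff|exact: compact_bump_supp].
have := open_nbhs_nbhs (conj (closed_openC clK) Kx).
by apply: filterS => y; exact: cube_bump_off.
Qed.

Lemma cube_bump0_gt0 : 0 < cube_bump 0.
Proof.
rewrite /cube_bump indicE mem_set ?mulr1; last first.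
  by have L1 := L0; move=> i; rewrite mxE; apply/andP; split; lra.
rewrite /periodic_bump /level (eq_bigr (fun=> 1)); last first.
  by move=> i _; rewrite mxE mulr0 cos0.
rewrite sumr_const card_ord -(prednK d0) /= -natrB//= subSnn.
by rewrite /flat ltr01 hornerC mul1r expR_gt0.
Qed.

End cube_bump.

(** * Inner products and Bessel's inequality *)

Section L2.
Context {R : realType} {d : nat} (Om : set 'rV[R]_d) (mOm : measurable Om).
Implicit Types (u v : 'rV[R]_d -> R) (f g h : 'rV[R]_d -> R[i]).

(** Integrals of complex functions are pairs of real integrals, so the
    sesquilinear algebra is reduced to a real bilinear form on the real and
    imaginary parts. *)
Definition sqr_integrable u : Prop :=
  measurable_fun Om u /\ (leb d).-integrable Om (fun x => (u x ^+ 2)%:E).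

Definition dot u v : R := \int[leb d]_(x in Om) (u x * v x).

Lemma integrable_dot u v : sqr_integrable u -> sqr_integrable v ->
  (leb d).-integrable Om (EFin \o (fun x => u x * v x)).
Proof.
move=> [mu iu] [mv iv]; apply: (le_integrable mOm _ _ (integrableD mOm iu iv)).
  by apply/measurable_EFinP; exact: measurable_funM.
move=> x _; rewrite /= lee_fin normrM.
rewrite [leRHS]ger0_norm ?addr_ge0 ?sqr_ge0//.
rewrite -(real_normK (num_real (u x))) -(real_normK (num_real (v x))).
have := sqr_ge0 (`|u x| - `|v x|).
have := sqr_ge0 `|u x|; have := sqr_ge0 `|v x|.
by rewrite sqrrB; lra.
Qed.

Lemma sqr_integrable_combination u v (a : R) :
  sqr_integrable u -> sqr_integrable v ->
  sqr_integrable (fun x => u x + a * v x).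
Proof.
move=> su sv; have [mu iu] := su; have [mv iv] := sv.
have mav : measurable_fun Om (fun x => a * v x) by exact: measurable_funM.
split; first exact: measurable_funD.
have := integrableD mOm (integrableD mOm iu (integrableZl mOm (2 * a)
  (integrable_dot su sv))) (integrableZl mOm (a ^+ 2) iv).
apply: eq_integrable => // x _ /=; rewrite -!EFinM -!EFinD; congr EFin; ring.
Qed.

Lemma dotC u v : dot u v = dot v u.
Proof. by apply: eq_Rintegral => x _; rewrite mulrC. Qed.

Lemma dotD u v1 v2 a : sqr_integrable u -> sqr_integrable v1 ->
  sqr_integrable v2 ->
  dot u (fun x => v1 x + a * v2 x) = dot u v1 + a * dot u v2.
Proof.
move=> su s1 s2.
have i1 := integrable_dot su s1; have i2 := integrable_dot su s2.
rewrite -RintegralZl// -RintegralD//.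
  by apply: eq_Rintegral => x _; ring.
exact: (integrableZl mOm a i2).
Qed.

Local Notation Re := (@complex.Re R).
Local Notation Im := (@complex.Im R).

Lemma normc_sqr (z : R[i]) : Normc.normc z ^+ 2 = Re z ^+ 2 + Im z ^+ 2.
Proof. by case: z => a b; rewrite /= sqr_sqrtr// addr_ge0// sqr_ge0. Qed.

Lemma Lp2P f :
  Lp2 Om f <-> sqr_integrable (Re \o f) /\ sqr_integrable (Im \o f).
Proof.
split=> [[mr mi fi]|[[mr ir] [mi ii]]].
- have nn : (leb d).-integrable Om (fun x => (Normc.normc (f x) ^+ 2)%:E).
    apply/integrableP; split.
      apply/measurable_EFinP; under eq_fun do rewrite normc_sqr.
      by apply: measurable_funD; apply: measurable_funX.
    by under eq_integral do rewrite gee0_abs ?lee_fin ?sqr_ge0//.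
  split; split=> //; apply: (le_integrable mOm _ _ nn).
  + by apply/measurable_EFinP; exact: measurable_funX.
  + move=> x _; rewrite /= lee_fin !ger0_norm ?sqr_ge0//.
    by rewrite normc_sqr lerDl sqr_ge0.
  + by apply/measurable_EFinP; exact: measurable_funX.
  + move=> x _; rewrite /= lee_fin !ger0_norm ?sqr_ge0//.
    by rewrite normc_sqr lerDr sqr_ge0.
- split=> //; have /integrableP[_] := integrableD mOm ir ii.
  by under eq_integral do rewrite gee0_abs ?lee_fin ?addr_ge0 ?sqr_ge0//
    -EFinD -normc_sqr.
Qed.

Lemma Lp2D f g (c : R[i]) : Lp2 Om f -> Lp2 Om g ->
  Lp2 Om (fun x => f x + c * g x).
Proof.
move=> /Lp2P[fr fi] /Lp2P[gr gi]; apply/Lp2P; split.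
- have := sqr_integrable_combination (- Im c)
    (sqr_integrable_combination (Re c) fr gr) gi.
  congr sqr_integrable; apply/funext => x /=.
  by case: c (f x) (g x) => a b [? ?] [? ?] /=; ring.
- have := sqr_integrable_combination (Im c)
    (sqr_integrable_combination (Re c) fi gi) gr.
  congr sqr_integrable; apply/funext => x /=.
  by case: c (f x) (g x) => a b [? ?] [? ?] /=; ring.
Qed.

Lemma inner_dot f g : Lp2 Om f -> Lp2 Om g ->
  inner Om f g = Complex
    (dot (Re \o f) (Re \o g) + dot (Im \o f) (Im \o g))
    (dot (Re \o f) (Im \o g) - dot (Im \o f) (Re \o g)).
Proof.
move=> /Lp2P[fr fi] /Lp2P[gr gi]; rewrite /inner /cintegral; congr Complex.
- rewrite -RintegralD//; [|exact: integrable_dot..].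
  by apply: eq_Rintegral => x _ /=; case: (f x) (g x) => ? ? [? ?] /=; ring.
- rewrite -RintegralB//; [|exact: integrable_dot..].
  by apply: eq_Rintegral => x _ /=; case: (f x) (g x) => ? ? [? ?] /=; ring.
Qed.

Lemma normsq_dot f : Lp2 Om f ->
  normsq Om f = dot (Re \o f) (Re \o f) + dot (Im \o f) (Im \o f).
Proof.
move=> /Lp2P[fr fi]; rewrite -RintegralD//; [|exact: integrable_dot..].
by apply: eq_Rintegral => x _; rewrite normc_sqr /= !expr2.
Qed.

Lemma inner_normsq f : Lp2 Om f -> inner Om f f = (normsq Om f)%:C%C.
Proof.
move=> Lf; rewrite inner_dot// normsq_dot//.
by rewrite (dotC (Im \o f) (Re \o f)) subrr.
Qed.

Lemma inner_conj f g : Lp2 Om f -> Lp2 Om g ->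
  inner Om f g = conjc (inner Om g f).
Proof.
move=> Lf Lg; rewrite !inner_dot//= ![dot (_ \o g) _]dotC; congr Complex.
by rewrite opprB.
Qed.

Lemma innerD f g h (c : R[i]) : Lp2 Om f -> Lp2 Om g -> Lp2 Om h ->
  inner Om f (fun x => g x + c * h x) = inner Om f g + c * inner Om f h.
Proof.
move=> Lf Lg Lh; rewrite !inner_dot//; last exact: Lp2D.
have [fr fi] := (Lp2P f).1 Lf; have [gr gi] := (Lp2P g).1 Lg.
have [hr hi] := (Lp2P h).1 Lh.
have Er : Re \o (fun x => g x + c * h x) =
    fun x => (Re \o g) x + Re c * (Re \o h) x + - Im c * (Im \o h) x.
  by apply/funext => x /=; case: (c) (g x) (h x) => ? ? [? ?] [? ?] /=; ring.
have Ei : Im \o (fun x => g x + c * h x) =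
    fun x => (Im \o g) x + Re c * (Im \o h) x + Im c * (Re \o h) x.
  by apply/funext => x /=; case: (c) (g x) (h x) => ? ? [? ?] [? ?] /=; ring.
have sr := sqr_integrable_combination (Re c) gr hr.
have si := sqr_integrable_combination (Re c) gi hi.
rewrite Er Ei !(dotD _ _ sr)// !(dotD _ _ si)// !dotD//.
case: (c) => a b /=; apply/eqP; rewrite eq_complex /=.
by apply/andP; split; apply/eqP; ring.
Qed.

Lemma sqr_integrable0 : sqr_integrable (fun=> 0).
Proof.
split; first exact: measurable_cst.
by under eq_fun do rewrite expr0n/=; exact: integrable0.
Qed.

Lemma Lp20 : Lp2 Om (fun=> 0).
Proof. by apply/Lp2P; split; exact: sqr_integrable0. Qed.

Lemma innerZ f g (c : R[i]) : Lp2 Om f -> Lp2 Om g ->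
  inner Om f (fun x => c * g x) = c * inner Om f g.
Proof.
move=> Lf Lg; have := innerD c Lf Lp20 Lg.
rewrite (_ : (fun x => 0 + _) = (fun x => c * g x)); last first.
  by apply/funext => x; rewrite add0r.
move=> ->; rewrite (_ : inner Om f (fun=> 0) = 0) ?add0r//.
rewrite /inner /cintegral; under eq_Rintegral do rewrite mulr0/=.
under [X in Complex _ X]eq_Rintegral do rewrite mulr0/=.
by rewrite /Rintegral integral0.
Qed.

(** Pythagoras: subtracting the orthogonal projection onto a unit vector [f]
    removes the squared modulus of the coefficient. *)
Lemma normsq_remainder f g (c : R[i]) : Lp2 Om f -> Lp2 Om g ->
  inner Om f f = 1 -> c = inner Om f g ->
  normsq Om (fun x => g x - c * f x) = normsq Om g - Normc.normc c ^+ 2.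
Proof.
move=> Lf Lg f1 cE.
have Lr : Lp2 Om (fun x => g x + - c * f x) by exact: Lp2D.
have -> : (fun x => g x - c * f x) = (fun x => g x + - c * f x).
  by apply/funext => x; rewrite mulNr.
have fr0 : inner Om f (fun x => g x + - c * f x) = 0.
  by rewrite innerD// f1 mulr1 -cE subrr.
rewrite -[LHS]/(Re (normsq Om (fun x => g x + - c * f x))%:C%C) -inner_normsq//.
rewrite innerD// (inner_conj Lr Lf) fr0 (inner_conj Lr Lg) innerD//.
rewrite (inner_conj Lg Lf) -cE inner_normsq// normc_sqr.
by case: c {Lr fr0 cE} => a b /=; ring.
Qed.

Lemma normsq_ge0 f : 0 <= normsq Om f.
Proof. by apply: Rintegral_ge0 => x _; exact: sqr_ge0. Qed.

Section bessel.
Variables (psi : nat -> 'rV[R]_d -> R[i]) (f : 'rV[R]_d -> R[i]).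
Hypotheses (Lpsi : forall k, Lp2 Om (psi k)) (Lf : Lp2 Om f).
Hypothesis orth : forall k l, inner Om (psi k) (psi l) = (k == l)%:R.
Local Notation c k := (inner Om (psi k) f).
Local Notation r n := (fun x => f x - \sum_(k < n) c k * psi k x).

Lemma remainderS n : r n.+1 = (fun x => r n x - c n * psi n x).
Proof. by apply/funext => x; rewrite big_ord_recr/= opprD addrA. Qed.

(** The second component is what lets the induction continue: the remainder has
    the same coefficients as [f] on the vectors not yet used. *)
Lemma bessel_remainder n : [/\ Lp2 Om (r n),
  forall l, (n <= l)%N -> inner Om (psi l) (r n) = c l &
  normsq Om (r n) = normsq Om f - \sum_(k < n) Normc.normc (c k) ^+ 2].
Proof.
elim: n => [|n [Lr rl nr]].
  have -> : r 0%N = f by apply/funext => x; rewrite big_ord0 subr0.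
  by rewrite big_ord0 subr0.
have rE : (fun x => r n x - c n * psi n x) = (fun x => r n x + - c n * psi n x).
  by apply/funext => x; rewrite mulNr.
rewrite remainderS; split.
- by rewrite rE; exact: Lp2D.
- move=> l nl; rewrite rE innerD// rl ?(ltnW nl)// orth (gtn_eqF nl).
  by rewrite mulr0 addr0.
- by rewrite normsq_remainder ?orth ?eqxx ?rl// nr big_ord_recr/= opprD addrA.
Qed.

Lemma bessel n : \sum_(k < n) Normc.normc (c k) ^+ 2 <= normsq Om f.
Proof.
have [_ _ nr] := bessel_remainder n.
by rewrite -subr_ge0 -nr normsq_ge0.
Qed.

End bessel.
End L2.

(** * Real test functions in the form domain *)

Section real_valued.
Context {R : realType} {d : nat}.
Implicit Types (h : 'rV[R]_d -> R) (K Om : set 'rV[R]_d).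

Definition toC h : 'rV[R]_d -> R[i] := fun x => (h x)%:C%C.

Lemma partialC_toC i h : partialC i (toC h) = toC (partial i h).
Proof.
apply/funext => x; congr Complex.
by rewrite /partial -[X in 'D__ X _]/(cst 0) derive_cst.
Qed.

Lemma smoothC_toC h : smooth h -> smoothC (toC h).
Proof. by split=> //; exact: elementary_smooth (elem_cst 0). Qed.

Lemma Cc_infty_toC Om K h : smooth h -> compact K -> K `<=` Om ->
  (forall x, ~ K x -> h x = 0) -> Cc_infty Om (toC h).
Proof.
move=> sh cK KO h0; split; first exact: smoothC_toC.
by exists K; split=> // x /h0; rewrite /toC => ->.
Qed.

Lemma Lp2_toC (L : R) K h : 0 < L -> continuous h -> compact K ->
  (forall x, ~ K x -> h x = 0) -> Lp2 (cube L) (toC h).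
Proof.
move=> L0 ch cK h0; have [C HC] := off_compact_bounded cK ch h0.
have mh : measurable_fun (cube L) h.
  by apply: measurable_funTS; exact: continuous_measurable_rV.
have mL := @measurable_cube R d L.
apply/(Lp2P mL); split; last exact: sqr_integrable0.
split=> //; apply: (integrable_cube (ltW L0) (C := C ^+ 2)) => //.
  exact: measurable_funX.
by move=> x _; rewrite normrX lerXn2r// ?nnegrE// (le_trans _ (HC x)).
Qed.

Lemma inner_toC Om h (f : 'rV[R]_d -> R[i]) :
  inner Om (toC h) f = cintegral Om (fun x => f x * toC h x).
Proof.
congr cintegral; apply/funext => x; rewrite /toC; case: (f x) => a b /=.
by congr Complex; ring.
Qed.

Lemma weak_gradient_toC (L : R) K h : 0 < L -> smooth h -> compact K ->
  K `<=` cube L -> (forall x, ~ K x -> h x = 0) ->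
  weak_gradient (cube L) (toC h) (fun i => toC (partial i h)).
Proof.
move=> L0 sh cK KL h0 i theta [[sr si] _].
rewrite /cintegral /toC; apply/eqP; rewrite eq_complex /=.
apply/andP; split; apply/eqP.
- transitivity (\int[leb d]_(x in cube L)
      (h x * partial i (fun y => complex.Re (theta y)) x)).
    by apply: eq_Rintegral => x _; ring.
  rewrite (Rintegral_by_parts i L0 cK KL h0 sh sr); congr (- _).
  by apply: eq_Rintegral => x _; case: (theta x) => a b /=; ring.
- transitivity (\int[leb d]_(x in cube L)
      (h x * partial i (fun y => complex.Im (theta y)) x)).
    by apply: eq_Rintegral => x _; ring.
  rewrite (Rintegral_by_parts i L0 cK KL h0 sh si); congr (- _).
  by apply: eq_Rintegral => x _; case: (theta x) => a b /=; ring.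
Qed.

Lemma normsq_eq0 Om (f : 'rV[R]_d -> R[i]) :
  (forall x, Om x -> f x = 0) -> normsq Om f = 0.
Proof.
move=> f0; transitivity (\int[leb d]_(x in Om) (0 : R)); last first.
  by rewrite /Rintegral integral0.
apply: eq_Rintegral => x /set_mem /f0 ->.
by rewrite normc_sqr /= !expr0n addr0.
Qed.

(** Only the values on the domain count in the closure, so a single smooth
    function that agrees there with [u] serves as a constant approximating
    sequence. *)
Lemma H1_closure_cst (S : set ('rV[R]_d -> R[i])) Om u g theta :
  H1 Om u g -> S theta ->
  (forall x, Om x -> theta x = u x) ->
  (forall i x, Om x -> partialC i theta x = g i x) ->
  H1_closure Om S u g.
Proof.
move=> Hu St tu tg; split=> //; exists (fun=> theta); split=> // [|i].
- rewrite (_ : (fun _ => _) = (fun=> 0)); first exact: cvg_cst.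
  by apply/funext => _; apply: normsq_eq0 => x /tu ->; rewrite subrr.
- rewrite (_ : (fun _ => _) = (fun=> 0)); first exact: cvg_cst.
  by apply/funext => _; apply: normsq_eq0 => x /tg ->; rewrite subrr.
Qed.

Lemma form_domain_H1 bc (L : R) u g :
  form_domain bc L u g -> H1 (@cube R d L) u g.
Proof. by case: bc => [[]| |[]]. Qed.

Lemma inner_toC_Nsum (Om : set 'rV[R]_d) (mOm : measurable Om) (I : Type)
    (s : seq I) (f : 'rV[R]_d -> R[i]) (h : I -> 'rV[R]_d -> R) :
  Lp2 Om f -> (forall i, Lp2 Om (toC (h i))) ->
  Lp2 Om (toC (fun x => - \sum_(i <- s) h i x)) /\
  inner Om f (toC (fun x => - \sum_(i <- s) h i x)) =
  - \sum_(i <- s) inner Om f (toC (h i)).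
Proof.
move=> Lf Lh; elim: s => [|i s [LS IHs]].
  have -> : toC (fun x => - \sum_(i <- [::]) h i x) = fun=> 0.
    by apply/funext => x; rewrite /toC big_nil oppr0.
  split; first exact: Lp20.
  rewrite big_nil oppr0 -[RHS](mul0r (inner Om f (fun=> 0))) -innerZ//.
    by congr inner; apply/funext => x; rewrite mul0r.
  exact: Lp20.
have -> : toC (fun x => - \sum_(j <- i :: s) h j x) =
    fun x => toC (fun x => - \sum_(i <- s) h i x) x + - 1 * toC (h i) x.
  apply/funext => x; rewrite /toC big_cons mulN1r opprD addrC.
  exact: (rmorphB (real_complex R)).
split; first exact: Lp2D.
by rewrite innerD// IHs big_cons mulN1r opprD addrC.
Qed.

End real_valued.

Section test_function.
Context {R : realType} {d : nat} (d0 : (0 < d)%N) (L : R) (L0 : 0 < L).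
Local Notation b := (@cube_bump R d L).
Local Notation Om := (@cube R d L).
Let mOm : measurable Om := measurable_cube L.
Let sb : smooth b := smooth_cube_bump L0.
Let cK : compact (@bump_supp R d L) := @compact_bump_supp R d L.
Let KL : @bump_supp R d L `<=` Om := bump_supp_cube L0.

Let b_off : forall x, ~ bump_supp L x -> b x = 0 := cube_bump_off L0.

Let db_off i : forall x, ~ bump_supp L x -> partial i b x = 0.
Proof.
move=> x; apply: partial_off b_off; exact: compact_closed.
Qed.

Let ddb_off i : forall x, ~ bump_supp L x -> partial i (partial i b) x = 0.
Proof.
move=> x; apply: partial_off (db_off i); exact: compact_closed.
Qed.

Let sdb i : smooth (partial i b) := smooth_partial i sb.
Let sddb i : smooth (partial i (partial i b)) := smooth_partial i (sdb i).

Let Lb : Lp2 Om (toC b) := Lp2_toC L0 (smooth_continuous sb) cK b_off.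
Let Ldb i : Lp2 Om (toC (partial i b)) :=
  Lp2_toC L0 (smooth_continuous (sdb i)) cK (db_off i).
Let Lddb i : Lp2 Om (toC (partial i (partial i b))) :=
  Lp2_toC L0 (smooth_continuous (sddb i)) cK (ddb_off i).

(** The approximating function is [b] itself for the Dirichlet condition and
    its periodic extension for the periodic one. *)
Lemma form_domain_bump bc :
  form_domain bc L (toC b) (fun i => toC (partial i b)).
Proof.
have H : H1 Om (toC b) (fun i => toC (partial i b)).
  by split=> //; exact: (weak_gradient_toC L0 sb cK KL b_off).
case: bc => //=.
- apply: (H1_closure_cst (theta := toC b)) => //.
    exact: (Cc_infty_toC sb cK KL b_off).
  by move=> i x _; rewrite partialC_toC.
- have bp x : Om x -> periodic_bump L x = b x.
    by move=> Lx; rewrite /cube_bump indicE mem_set// mulr1.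
  apply: (H1_closure_cst (theta := toC (periodic_bump L))) => //.
  + split; first exact: smoothC_toC (smooth_periodic_bump _).
    by move=> i x; rewrite /toC (periodic_bump_periodic L0).
  + by move=> x /bp; rewrite /toC => ->.
  + move=> i x Lx; rewrite partialC_toC /toC; congr (_%:C)%C.
    apply: near_eq_derive; have := open_nbhs_nbhs (conj (@open_cube R d L) Lx).
    by apply: filterS => y; exact: bp.
Qed.

Definition neglap_bump : 'rV[R]_d -> R[i] :=
  toC (fun x => - \sum_(i < d) partial i (partial i b) x).

Lemma Lp2_neglap_bump : Lp2 Om neglap_bump.
Proof. exact: (inner_toC_Nsum mOm _ Lb Lddb).1. Qed.

(** Formally this is self-adjointness of the Laplacian. The form identity of
    [psi] is tested against [b], which lies in the form domain, and gives
    E <b, psi> = sum_i <d_i b, g_i>; the weak gradient [g] of [psi] is then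
    tested against the compactly supported functions [partial i b], which moves
    the second derivative onto [b]. *)
Lemma inner_neglap_bump bc (psi : 'rV[R]_d -> R[i]) (E : R) :
  Lp2 Om psi ->
  schroedinger bc L (fun=> 0) psi (fun x => E%:C%C * psi x) ->
  inner Om psi neglap_bump = E%:C%C * inner Om psi (toC b).
Proof.
move=> Lpsi [_ [g /[dup] fg /form_domain_H1[_ Lg wg]]].
move=> /(_ _ _ (form_domain_bump bc)).
have -> : (fun x => E%:C%C * psi x - (0 : R)%:C%C * psi x) =
    (fun x => E%:C%C * psi x).
  by apply/funext => x; rewrite mul0r subr0.
rewrite innerZ// => gE.
have ig i : inner Om (toC (partial i b)) (g i) =
    - conjc (inner Om psi (toC (partial i (partial i b)))).
  rewrite inner_toC -[LHS]opprK -wg; last first.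
    exact: (Cc_infty_toC (sdb i) cK KL (db_off i)).
  by rewrite partialC_toC -inner_toC inner_conj.
rewrite (inner_toC_Nsum mOm _ Lpsi Lddb).2.
have conjR : conjc (E%:C%C * inner Om psi (toC b)) =
    E%:C%C * inner Om (toC b) psi.
  rewrite rmorphM; congr (_ * _); first exact: conjc_real.
  by rewrite (inner_conj mOm Lb Lpsi).
rewrite -[LHS]conjcK -[RHS]conjcK; congr conjc.
rewrite rmorphN rmorph_sum -sumrN conjR -gE.
by apply: eq_bigr => i _; rewrite ig.
Qed.

Lemma normsq_bump_gt0 : 0 < normsq Om (toC b).
Proof.
pose c := b 0 / 2; have b0 := cube_bump0_gt0 d0 L0.
have c0 : 0 < c by rewrite divr_gt0.
have O0 : Om 0 by apply: KL => i; rewrite mxE normr0 divr_ge0// ltW.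
have nc : nbhs (0 : 'rV[R]_d) [set y : 'rV[R]_d | c < b y].
  have cb : c < b 0 by rewrite /c; lra.
  by have := smooth_continuous sb (lt_nbhsr cb).
(* The bump exceeds half its value at the origin on a small cube. *)
have nO := open_nbhs_nbhs (conj (@open_cube R d L) O0).
have [r r0 rA] := nbhs_box (filterI nc nO).
have E2 x : Normc.normc (toC b x) ^+ 2 = b x ^+ 2.
  by rewrite normc_sqr /= expr0n addr0.
apply: fine_gt0; apply/andP; split; last by have [] := Lb.
have mb2 : measurable_fun Om (fun x => (Normc.normc (toC b x) ^+ 2)%:E).
  apply/measurable_EFinP; under eq_fun do rewrite E2.
  apply: measurable_funX; apply: measurable_funTS.
  by apply: continuous_measurable_rV; exact: smooth_continuous.
have cr : box 0 r = @cube R d (2 * r).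
  by apply/seteqP; split=> x h i; have := h i; rewrite /= mxE subr0 ltr_norml
    [2 * r]mulrC mulfK.
have rOm : @cube R d (2 * r) `<=` Om by rewrite -cr => x /rA[].
have r20 : 0 <= 2 * r by rewrite mulr_ge0// ltW.
apply: (@lt_le_trans _ _ ((c ^+ 2)%:E * leb d (@cube R d (2 * r)))%E).
  by rewrite leb_cube// -EFinM lte_fin mulr_gt0// exprn_gt0// mulr_gt0.
rewrite -integral_cst; last exact: measurable_cube.
apply: (@le_trans _ _ (\int[leb d]_(x in cube (2 * r))
    (Normc.normc (toC b x) ^+ 2)%:E)%E).
  apply: ge0_le_integral => //.
  - exact: measurable_cube.
  - by move=> x _; rewrite lee_fin sqr_ge0.
  - exact: measurable_funS mb2.
  - move=> x; rewrite -cr => /rA[/= cx _]; rewrite lee_fin E2.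
    by rewrite lerXn2r ?nnegrE ?ltW// (lt_trans c0).
apply: ge0_subset_integral => //; first exact: measurable_cube.
by move=> x _; rewrite lee_fin sqr_ge0.
Qed.

End test_function.

(** * The counterexample *)

Section polynomial_decay.
Context {R : realType} {d : nat}.

Lemma nonzero_coefficient (Om : set 'rV[R]_d)
    (psi : nat -> 'rV[R]_d -> R[i]) f :
  normsq Om (fun x => f x - \sum_(k < n) inner Om (psi k) f * psi k x)
    @[n --> \oo] --> (0 : R) ->
  normsq Om f != 0 -> exists k, inner Om (psi k) f != 0.
Proof.
move=> cvg0 f0; apply: contrapT => /forallNP c0; move/eqP: f0; apply.
rewrite (_ : (fun n => _) = (fun=> normsq Om f)) in cvg0.
  by have := cvg_unique _ (@cvg_cst _ (normsq Om f) _ \oo _) cvg0; apply.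
apply/funext => n; congr (normsq Om); apply/funext => x.
rewrite big1 ?subr0// => k _; have /negP := c0 k.
by rewrite negbK => /eqP ->; rewrite mul0r.
Qed.

(** The numbers E_k alpha_k are the coefficients of minus the Laplacian of the
    bump, so Bessel's inequality bounds the weighted sum by a finite [M]; any
    nonzero coefficient makes the unweighted sum at least some a > 0, and
    D = 1 + M/a works. *)
Lemma bounded_energy (L : R) (bc : boundary_condition) (E : nat -> R)
    (psi : nat -> 'rV[R]_d -> R[i]) : (0 < d)%N -> 0 < L ->
  eigenbasis bc L (fun=> 0) E psi ->
  exists2 D : R, 1 <= D &
  (\sum_(0 <= k <oo) ((Num.max 0 (E k)) `^ 2 *
      Normc.normc (inner (cube L) (psi k) (toC (cube_bump L))) ^+ 2)%:E
    <= D%:E * \sum_(0 <= k <oo)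
      (Normc.normc (inner (cube L) (psi k) (toC (cube_bump L))) ^+ 2)%:E)%E.
Proof.
move=> d0 L0 [_ hs horth hcomp].
have mOm := @measurable_cube R d L.
set al := fun k => inner (cube L) (psi k) (toC (cube_bump L)).
have Lpsi k : Lp2 (cube L) (psi k).
  by have [_ [g /form_domain_H1[]]] := hs k.
have Lb : Lp2 (cube L) (toC (@cube_bump R d L)).
  by have [] := form_domain_H1 (form_domain_bump (d := d) L0 bc).
have LF := Lp2_neglap_bump (d := d) L0.
have Fal k : inner (cube L) (psi k) (neglap_bump L) = (E k)%:C%C * al k.
  exact: inner_neglap_bump (Lpsi k) (hs k).
have [k0 k0P] : exists k, al k != 0.
  apply: nonzero_coefficient (hcomp _ Lb) _.
  by rewrite gt_eqF// normsq_bump_gt0.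
pose M := normsq (cube L) (@neglap_bump R d L).
pose a := Normc.normc (al k0) ^+ 2.
have a0 : 0 < a.
  rewrite lt0r sqr_ge0 andbT sqrf_eq0.
  by apply: contra k0P => /eqP /Normc.eq0_normc ->.
have M0 : 0 <= M := normsq_ge0 _ _.
exists (1 + M / a); first by rewrite lerDl divr_ge0// ltW.
apply: (@le_trans _ _ M%:E).
  apply: lime_le.
    apply: is_cvg_nneseries => k _ _.
    by rewrite lee_fin mulr_ge0 ?powR_ge0 ?sqr_ge0.
  near=> n; rewrite sumEFin lee_fin big_mkord.
  apply: le_trans (bessel mOm Lpsi LF horth n); apply: ler_sum => k _.
  rewrite Fal Normc.normcM exprMn.
  rewrite ler_wpM2r ?sqr_ge0// -[2]/(2%:R) powR_mulrn ?le_max ?lexx//.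
  rewrite normc_sqr /= expr0n addr0 -[leRHS]real_normK ?num_real//.
  by rewrite lerXn2r ?nnegrE ?le_max ?lexx// ge_max normr_ge0 ler_norm.
have aS : (a%:E <= \sum_(0 <= k <oo) (Normc.normc (al k) ^+ 2)%:E)%E.
  apply: le_trans (nneseries_lim_ge k0.+1 _); last first.
    by move=> k _ _; rewrite lee_fin sqr_ge0.
  rewrite sumEFin lee_fin big_mkord big_ord_recr /= lerDr.
  by apply: sumr_ge0 => k _; exact: sqr_ge0.
apply: le_trans (lee_wpmul2l _ aS); last first.
  by rewrite lee_fin addr_ge0// divr_ge0// ltW.
by rewrite -EFinM lee_fin mulrDl mul1r divfK ?gt_eqF// lerDr ltW.
Unshelve. all: by end_near. Qed.

(** Modulo G, the coordinates of a point at distance less than G/16 from a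
    center lie between 5G/16 and 7G/16: inside the cell, and away from the
    interval of radius G/4 that carries the bump. *)
Definition centers (G : R) (j : 'rV[R]_d) : 'rV[R]_d :=
  j + const_mx (3 * G / 8).

Lemma eball_coord (x y : 'rV[R]_d) r i :
  eball x r y -> `|y ord0 i - x ord0 i| < r.
Proof.
apply: le_lt_trans; rewrite -sqrtr_sqr ler_wsqrtr// (bigD1 i)//= lerDl.
by apply: sumr_ge0 => j _; exact: sqr_ge0.
Qed.

Lemma equidistributed_centers (G : R) : 0 < G ->
  equidistributed G (G / 16) (centers G).
Proof.
move=> G0 j _ y yj; exists (y - j); last by rewrite subrK.
move=> i; have := eball_coord i yj; rewrite !mxE ltr_norml => /andP[h1 h2].
by apply/andP; split; lra.
Qed.

Lemma Wset_bump_supp (G : R) : 0 < G -> (0 < d)%N ->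
  Wset G (G / 16) (centers G) G `<=` ~` bump_supp G.
Proof.
move=> G0 d0 x [[j [k ->]] xj _] /(_ (Ordinal d0)).
have := eball_coord (Ordinal d0) xj; rewrite !mxE.
set m := k _ _; set t := x _ _; rewrite ltr_norml ler_norml.
move=> /andP[h1 h2] /andP[h3 h4].
have [m0|m0] := leP 0 m.
  have : 0 <= G * m%:~R by rewrite mulr_ge0 ?ler0z// ltW.
  lra.
have : G * m%:~R <= - G.
  rewrite -[leRHS]mulrN1 ler_pM2l// -[leRHS]/((-1)%:~R) ler_int.
  by lia.
lra.
Qed.

End polynomial_decay.

(* [E V L] and [psi V L] are the eigenvalues and the fixed orthonormal basis of
   eigenfunctions of H_L. *)
Theorem corollary4p2 (R : realType) (d : nat) (hd : (0 < d)%N)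
    (bc : boundary_condition)
    (E : ('rV[R]_d -> R) -> R -> nat -> R)
    (psi : ('rV[R]_d -> R) -> R -> nat -> 'rV[R]_d -> R[i])
    (hE : forall (V : 'rV[R]_d -> R) (L : R),
      measurable_bounded V -> 0 < L -> eigenbasis bc L V (E V L) (psi V L)) :
  ~ exists2 N : R, 0 < N &
    forall kappa : R, 0 < kappa ->
    forall G : R, 0 < G <= kappa / (18 * expR 1 * Num.sqrt d%:R) ->
    forall delta : R, 0 < delta < G / 2 ->
    forall z : 'rV[R]_d -> 'rV[R]_d, equidistributed G delta z ->
    forall V : 'rV[R]_d -> R, measurable_bounded V ->
    forall L : R, (exists2 n : nat, (0 < n)%N & L = G * n%:R) ->
    forall D : R, 1 <= D ->
    forall phi : 'rV[R]_d -> R[i], Lp2 (cube L) phi ->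
      let alpha k := inner (cube L) (psi V L k) phi in
      (\sum_(0 <= k <oo)
          ((Num.max 0 (E V L k)) `^ kappa * Normc.normc (alpha k) ^+ 2)%:E
        <= D%:E * \sum_(0 <= k <oo) (Normc.normc (alpha k) ^+ 2)%:E)%E ->
      (delta / G) `^ (N * (1 + G `^ (4 / 3) * infty_norm V `^ (2 / 3) + ln D))
          * normsq (cube L) phi
        <= normsq (Wset G delta z L) phi.
Proof.
move=> [N N0 H].
pose G : R := 2 / (18 * expR 1 * Num.sqrt d%:R).
have G0 : 0 < G.
  by rewrite divr_gt0// mulr_gt0 ?mulr_gt0 ?expR_gt0// sqrtr_gt0 ltr0n.
have mV : measurable_bounded (fun _ : 'rV[R]_d => 0 : R).
  by split; [exact: measurable_cst|exists 0 => x; rewrite normr0].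
have [D D1 HD] := bounded_energy hd G0 (hE _ _ mV G0).
have Lb : Lp2 (cube G) (toC (@cube_bump R d G)).
  by have [] := form_domain_H1 (form_domain_bump (d := d) G0 bc).
have GG : 0 < G <= 2 / (18 * expR 1 * Num.sqrt d%:R) by rewrite G0 lexx.
have dG : 0 < G / 16 < G / 2 by apply/andP; split; lra.
have L1 : exists2 n : nat, (0 < n)%N & G = G * n%:R.
  by exists 1%N; rewrite ?mulr1.
have := H 2 (ltr0Sn _ _) G GG (G / 16) dG _ (equidistributed_centers G0)
  _ mV G L1 D D1 _ Lb HD.
rewrite [leRHS]normsq_eq0; last first.
  by move=> x /(Wset_bump_supp G0 hd) /(cube_bump_off G0); rewrite /toC => ->.
apply/negP; rewrite -ltNge mulr_gt0 ?(normsq_bump_gt0 hd G0)//.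
by apply: powR_gt0; rewrite divr_gt0// divr_gt0.
Qed.
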